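(* Let $n \geq 4$, $m = n-2$, and $C = \{1,\ldots,n-2\}^3 \subseteq [n]^3$. For $q \in [n]^3$ let $\kappa(q) = |N[q] \cap C|$, where $N[q]$ is the closed neighbourhood of $q$ in the 3D queen graph $Q^3_n$. Then: (i) If $q$ is a corner vertex, then $\kappa(q) = m$. (ii) If $q$ lies on an edge but not at a corner, then $\kappa(q) = 2m-1$. (iii) If $q$ lies on a face but not on any edge, then $\kappa(q) \leq 5m-4-\varepsilon_m$, where $\varepsilon_m = (m-1) \bmod 2$, with equality when $q$ is the face centre and the face centre is a lattice point, which occurs precisely when $m$ is odd. (iv) If $q \in C$, then $\kappa(q) \leq 13m-12$, with equality when $q$ is the centre $\left(\tfrac{n-1}{2},\tfrac{n-1}{2},\tfrac{n-1}{2}\right)$ of the board (when this is a lattice point). In particular, $\max_{q \in \partial[n]^3} \kappa(q) < \max_{q \in C} \kappa(q)$ for all $n \geq 4$, where $\partial[n]^3 = [n]^3 \setminus C$.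
   Context: $[n] = \{0,1,\ldots,n-1\}$. The 3D queen graph $Q^3_n$ has vertex set $[n]^3$; two distinct vertices $v,w$ are adjacent iff $w - v$ is a nonzero integer multiple of one of the 13 direction vectors $(1,0,0),(0,1,0),(0,0,1)$, $(1,\pm1,0),(1,0,\pm1),(0,1,\pm1)$, $(1,\pm1,\pm1)$ (i.e., reachable by a 3D queen move along an axis, face diagonal, or space diagonal). $N[v] = \{v\} \cup \{w : w \sim v\}$. Call a coordinate extreme if it lies in $\{0,n-1\}$. A corner vertex has all three coordinates extreme; an edge vertex has at least two coordinates extreme (a non-corner edge vertex exactly two); a face vertex has at least one extreme coordinate, and a face vertex not on any edge has exactly one extreme coordinate. The face centre of such a face is the point whose two non-extreme coordinates both equal $(n-1)/2$. *)

(* Defs.v *)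
From mathcomp Require Import all_boot all_order all_algebra.
From mathcomp Require Import boolp.

Set Implicit Arguments.
Unset Strict Implicit.
Unset Printing Implicit Defensive.

Import GRing.Theory Num.Theory.
Local Open Scope ring_scope.

Definition vertex (n : nat) : finType := ('I_n * 'I_n * 'I_n)%type.

Definition directions : seq (int * int * int) :=
  [:: (1, 0, 0); (0, 1, 0); (0, 0, 1);
      (1, 1, 0); (1, -1, 0); (1, 0, 1); (1, 0, -1); (0, 1, 1); (0, 1, -1);
      (1, 1, 1); (1, 1, -1); (1, -1, 1); (1, -1, -1)].

Definition queen_adj (n : nat) (v w : vertex n) : Prop :=
  v <> w /\
  exists (k : int) (d : int * int * int),
    [/\ k <> 0, d \in directions &
     [/\ (w.1.1 : nat)%:Z - (v.1.1 : nat)%:Z = k * d.1.1,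
         (w.1.2 : nat)%:Z - (v.1.2 : nat)%:Z = k * d.1.2 &
         (w.2 : nat)%:Z - (v.2 : nat)%:Z = k * d.2]].

Definition closed_nbhd (n : nat) (v : vertex n) : {set vertex n} :=
  v |: [set w : vertex n | `[< queen_adj v w >]].

Definition core (n : nat) : {set vertex n} :=
  [set q : vertex n |
    all (fun x : 'I_n => (1 <= x)%N && (x <= n - 2)%N) [:: q.1.1; q.1.2; q.2]].

Definition kappa (n : nat) (q : vertex n) : nat :=
  #|closed_nbhd q :&: core n|.

Definition extreme (n : nat) (x : 'I_n) : bool :=
  ((x : nat) == 0%N) || ((x : nat) == (n - 1)%N).

Definition num_extreme (n : nat) (q : vertex n) : nat :=
  count (@extreme n) [:: q.1.1; q.1.2; q.2].

Definition is_corner (n : nat) (q : vertex n) : bool := num_extreme q == 3%N.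

(* Inclusive notions: a corner is an edge vertex, an edge vertex is a face
   vertex. *)
Definition is_edge (n : nat) (q : vertex n) : bool := (2 <= num_extreme q)%N.
Definition is_face (n : nat) (q : vertex n) : bool := (1 <= num_extreme q)%N.

(* Centres are rational points, as they need not lie on the board. *)
Definition point : Type := (rat * rat * rat)%type.

Definition vertex_point (n : nat) (q : vertex n) : point :=
  ((q.1.1 : nat)%:R, (q.1.2 : nat)%:R, (q.2 : nat)%:R).

Definition lattice_point (p : point) : Prop :=
  [/\ p.1.1 \is a Num.int, p.1.2 \is a Num.int & p.2 \is a Num.int].

Definition midcoord (n : nat) : rat := (n%:R - 1) / 2.

(* The six faces are indexed by the coordinate i that is constant on the face
   and by s, with s = false for the value 0 and s = true for n - 1. *)
Definition face_centre (n : nat) (i : 'I_3) (s : bool) : point :=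
  let c (j : nat) : rat :=
    if j == i then (if s then n%:R - 1 else 0) else midcoord n in
  (c 0%N, c 1%N, c 2%N).

Definition board_centre (n : nat) : point :=
  (midcoord n, midcoord n, midcoord n).

(* Main.v *)
Require Import Defs.
From mathcomp Require Import all_boot all_order all_algebra.
From mathcomp Require Import boolp zify.

Import GRing.Theory Num.Theory.

(** A vertex [w] is in the closed neighbourhood of [q] iff all coordinate
    distances lie in [{0, t}] for a single [t], so the queen moves at Chebyshev
    distance [t >= 1] landing in the core are the points other than [q] of a
    product of three sets of at most three coordinates each. Hence
    [kappa q = [q in C] + sum_(1 <= t < n) (A_1 A_2 A_3 - [q in C])], where
    [A_i (t)] is [[t <= n - 2]] for an extreme coordinate [x_i] and
    [1 + [t <= x_i - 1] + [t <= n - 2 - x_i]] otherwise. By AM-GM the mixed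
    products are bounded by squares (faces) or cubes (core), whose sums over
    [t] depend only on [min (x_i - 1) (n - 2 - x_i)], which is largest at the
    centre. *)

(** * Queen moves through coordinate distances *)

Definition dist (x y : nat) : nat := (x - y) + (y - x).

(** Up to sign, [directions] lists every nonzero vector with entries in [{0, 1, -1}]. *)
Lemma mem_closed_nbhdP {n : nat} (v w : vertex n) :
  reflect (exists t : nat,
      [/\ dist v.1.1 w.1.1 \in [:: 0; t], dist v.1.2 w.1.2 \in [:: 0; t]
        & dist v.2 w.2 \in [:: 0; t]])
    (w \in closed_nbhd v).
Proof.
rewrite !inE; apply: (iffP orP) => [[/eqP->|/asboolP[_ [k [d [_ dD]]]]]|[t]].
- by exists 0; rewrite /dist !subnn.
- case: v w => [[a b] c] [[a' b'] c'] /= [].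
  exists `|k|%N; move: dD; rewrite !inE /dist.
  by do !case/orP; move=> /eqP dE; subst d; simpl in *; split; lia.
case: v w => [[a b] c] [[a' b'] c'] /=; rewrite !inE => -[ta tb tc].
have [->|ne] := eqVneq (a', b', c') (a, b, c); [by left | right].
apply/asboolP; split=> [E|]; first by rewrite E eqxx in ne.
have t0 : t != 0.
  apply: contraNneq ne => t0; move: ta tb tc; rewrite t0 /dist => ta tb tc.
  by rewrite !xpair_eqE -!val_eqE /=; lia.
have signed (x y : nat) : (dist x y == 0) || (dist x y == t) ->
    exists2 e : int, e \in [:: 0; 1; -1]%R & (y%:Z - x%:Z = t%:Z * e)%R.
  rewrite /dist => xy; case: (ltngtP x y) => ?.
  - by exists 1%R; rewrite ?inE //; lia.
  - by exists (-1)%R; rewrite ?inE //; lia.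
  - by exists 0%R; rewrite ?inE //; lia.
have {signed} [[e1 s1 E1] [e2 s2 E2] [e3 s3 E3]] :=
  And3 (signed _ _ ta) (signed _ _ tb) (signed _ _ tc).
(* One vector of each opposite pair is listed; for the other one, multiplier and direction both
   change sign. *)
have [eD|eD] := boolP ((e1, e2, e3) \in directions).
  by exists (Posz t), (e1, e2, e3); split=> //=; lia.
exists (- Posz t)%R, (- e1, - e2, - e3)%R; split=> /=; first lia; last first.
  by split; rewrite mulrNN.
(* Only the zero vector is listed with neither sign, and it would make the two vertices equal. *)
move: s1 s2 s3 E1 E2 E3 eD; rewrite !inE.
do 2![case/or3P=> /eqP->]; case/or3P=> /eqP-> // Ea Eb Ec _.
by case/eqP: ne; congr (_, _, _); apply: val_inj => /=; lia.
Qed.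

(** * Splitting [kappa] by Chebyshev distance *)

Definition radius {n : nat} (q w : vertex n) : nat :=
  maxn (dist q.1.1 w.1.1) (maxn (dist q.1.2 w.1.2) (dist q.2 w.2)).

Definition reach {n : nat} (x : 'I_n) (t : nat) : {set 'I_n} :=
  [set y : 'I_n | (1 <= y <= n - 2) && (dist x y \in [:: 0; t])].

Lemma mem_reach {n : nat} (x y : 'I_n) (t : nat) :
  (y \in reach x t) = (1 <= y <= n - 2) && (dist x y \in [:: 0; t]).
Proof. by rewrite in_set. Qed.

Lemma radius_lt {n : nat} (q w : vertex n) : radius q w < n.
Proof.
case: q w => [[a b] c] [[a' b'] c']; rewrite /radius /dist /= !gtn_max.
have := (ltn_ord a, ltn_ord b, ltn_ord c, ltn_ord a', ltn_ord b', ltn_ord c').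
by move=> [[[[[? ?] ?] ?] ?] ?]; lia.
Qed.

Lemma radius_eq0 {n : nat} (q w : vertex n) : (radius q w == 0) = (w == q).
Proof.
case: q w => [[a b] c] [[a' b'] c'].
rewrite !xpair_eqE -!val_eqE /radius /dist /=; lia.
Qed.

(** The common distance given by [mem_closed_nbhdP] must equal the positive radius [t], so the three
    coordinate conditions become independent. *)
Lemma sphere_setX {n : nat} (q : vertex n) (t : nat) : 0 < t ->
  [set w in closed_nbhd q :&: core n | radius q w == t] =
  setX (setX (reach q.1.1 t) (reach q.1.2 t)) (reach q.2 t) :\ q.
Proof.
move=> t0; apply/setP => -[[a b] c]; set w := (a, b, c).
rewrite in_set in_setI in_setD1 -radius_eq0.
have -> : (w \in core n) =
    [&& 1 <= w.1.1 <= n - 2, 1 <= w.1.2 <= n - 2 & 1 <= w.2 <= n - 2].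
  by rewrite inE /= andbT.
rewrite !in_setX !mem_reach.
apply/andP/andP=> [[/andP[/mem_closed_nbhdP[s [sa sb sc]] wC]]|].
  move: sa sb sc wC; rewrite /radius /w !inE /= => sa sb sc wC /eqP rt.
  by split; lia.
move=> [r0 /andP[/andP[/andP[wa ta] /andP[wb tb]] /andP[wc tc]]]; split.
  rewrite wa wb wc !andbT; apply/mem_closed_nbhdP; exists t.
  by split.
by move: r0 ta tb tc; rewrite /radius /w !inE /=; lia.
Qed.

Lemma core_mem_reach {n : nat} (q : vertex n) (t : nat) :
  (q \in setX (setX (reach q.1.1 t) (reach q.1.2 t)) (reach q.2 t)) =
  (q \in core n).
Proof.
by case: q => [[a b] c]; rewrite !inE /dist /= !subnn !eqxx /=; lia.
Qed.

Lemma kappa_spheres {n : nat} (q : vertex n) :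
  kappa q = \sum_(0 <= t < n)
    #|[set w in closed_nbhd q :&: core n | radius q w == t]|.
Proof.
rewrite /kappa -sum1_card.
under [RHS]eq_bigr do rewrite -sum1dep_card big_mkcondr.
rewrite exchange_big; apply: eq_bigr => w _ /=.
rewrite big_mkord (bigD1 (Ordinal (radius_lt q w))) //= eqxx big1 // => i.
by rewrite -val_eqE /=; case: (radius q w =P i) => // ->; rewrite eqxx.
Qed.

(** If [q] is in the core, distance 0 contributes [q], and at each of the other [n.-1] distances the
    product counts [q] once too often. The correction stands on the left to avoid truncated
    subtraction. *)
Lemma kappa_sum_reach {n : nat} (q : vertex n) :
  kappa q + (q \in core n) * n.-1 =
  (q \in core n) +
  \sum_(1 <= t < n) #|reach q.1.1 t| * #|reach q.1.2 t| * #|reach q.2 t|.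
Proof.
have n0 : 0 < n := leq_ltn_trans (leq0n _) (ltn_ord q.2).
rewrite kappa_spheres big_ltn // -addnA; congr (_ + _).
  have -> : [set w in closed_nbhd q :&: core n | radius q w == 0] =
            if q \in core n then [set q] else set0.
    apply/setP => w; rewrite in_set in_setI radius_eq0.
    have [->|wq] := eqVneq w q; last first.
      by rewrite andbF; case: ifP => _; rewrite inE ?(negPf wq).
    by rewrite /closed_nbhd setU11; case: (q \in core n); rewrite inE ?eqxx.
  by case: ifP; rewrite ?cards1 ?cards0.
rewrite -[n.-1]subn1 mulnC -sum_nat_const_nat -big_split /=.
apply: eq_big_nat => t /andP[t1 _].
by rewrite sphere_setX // -!cardsX [in RHS](cardsD1 q) core_mem_reach addnC.
Qed.

(** * Sizes of the coordinate sets [reach] *)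

Lemma sum_ord_pred1 (n c : nat) (P : pred nat) :
  \sum_(y < n) ((y == c :> nat) && P y : nat) = (c < n) && P c.
Proof.
have [cn|cn] /= := ltnP c n.
  rewrite (bigD1 (Ordinal cn)) //= eqxx big1 ?addn0 // => i.
  by rewrite -val_eqE /= => /negPf ->.
by apply: big1 => i _; have := ltn_ord i; case: eqP => //=; lia.
Qed.

Lemma card_reach {n : nat} (x : 'I_n) (t : nat) : 0 < t ->
  #|reach x t| =
    (1 <= x <= n - 2) + (t < x <= t + (n - 2)) + (1 <= x + t <= n - 2).
Proof.
move=> t0; have xn := ltn_ord x.
pose P y := 1 <= y <= n - 2.
rewrite -sum1dep_card big_mkcond /=.
(* If [t >= x], the truncated [x - t] is 0, which [P] rejects. Since [t > 0], no [y] satisfying [P]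
   passes two of the tests. *)
transitivity (\sum_(y < n) (((y == x :> nat) && P y) +
    ((y == x - t :> nat) && P y) + ((y == x + t :> nat) && P y))).
  apply: eq_bigr => y _; have := ltn_ord y; rewrite /P !inE /dist.
  case: ifP; lia.
rewrite !big_split /= !sum_ord_pred1 /P; lia.
Qed.

(** The coordinate itself is outside the core range, and only the inward step can enter it. *)
Lemma card_reach_extreme {n : nat} (x : 'I_n) (t : nat) :
  0 < t -> extreme x -> #|reach x t| = (t <= n - 2).
Proof.
move=> t0; rewrite /extreme card_reach //; have := ltn_ord x; lia.
Qed.

Lemma card_reach_inner {n : nat} (x : 'I_n) (t : nat) :
  0 < t -> ~~ extreme x -> #|reach x t| = 1 + (t <= x - 1) + (t <= n - 2 - x).
Proof.
move=> t0; rewrite /extreme card_reach //; have := ltn_ord x; lia.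
Qed.

(** * Sums of indicators over the distance *)

Lemma sum_leq_indicator (n u : nat) : u < n ->
  \sum_(1 <= t < n) (t <= u : nat) = u.
Proof.
move=> un; rewrite (big_cat_nat _ (n := u.+1)) //=.
rewrite (eq_big_nat _ _ (F2 := fun=> 1)) => [|t /andP[_ ?]]; last lia.
rewrite sum_nat_const_nat [X in _ + X]big1_seq; first lia.
by move=> t; rewrite mem_index_iota; lia.
Qed.

(** Products of sizes of [reach] expand to this form: indicators are idempotent, and those of
    [t <= u] and [t <= v] multiply to that of [t <= minn u v]. *)
Lemma sum_leq_combination (n c0 c1 c2 w u v : nat) : w < n -> u < n -> v < n ->
  \sum_(1 <= t < n)
    (c0 * (t <= w) + c1 * ((t <= u) + (t <= v)) + c2 * (t <= minn u v)) =
  c0 * w + c1 * (u + v) + c2 * minn u v.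
Proof.
move=> wn un vn; rewrite !big_split /= -!big_distrr /= big_split /=.
by rewrite !sum_leq_indicator // gtn_min un.
Qed.

Lemma mem_core {n : nat} (q : vertex n) :
  (q \in core n) = (num_extreme q == 0).
Proof.
case: q => [[a b] c]; rewrite inE /num_extreme /= /extreme.
have := (ltn_ord a, ltn_ord b, ltn_ord c); move=> [[? ?] ?]; lia.
Qed.

(** * Corners, edges and faces *)

Lemma sum_reach_corner {n : nat} (x y z : 'I_n) : 2 <= n ->
  extreme x -> extreme y -> extreme z ->
  \sum_(1 <= t < n) #|reach x t| * #|reach y t| * #|reach z t| = n - 2.
Proof.
move=> n2 ex ey ez.
rewrite -[RHS](@sum_leq_indicator n); last by rewrite ltn_subrL; lia.
apply: eq_big_nat => t /andP[t0 _]; rewrite !card_reach_extreme //.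
by case: (t <= n - 2).
Qed.

Lemma sum_reach_edge {n : nat} (x y z : 'I_n) : 3 <= n ->
  extreme x -> extreme y -> ~~ extreme z ->
  \sum_(1 <= t < n) #|reach x t| * #|reach y t| * #|reach z t| =
  2 * (n - 2) - 1.
Proof.
move=> n3 ex ey ez; have zn := ltn_ord z.
transitivity (1 * (n - 2) + 1 * ((z - 1) + (n - 2 - z))
              + 0 * minn (z - 1) (n - 2 - z)); last first.
  by move: ez; rewrite /extreme; lia.
rewrite -(@sum_leq_combination n); [|lia..].
apply: eq_big_nat => t /andP[t0 _].
rewrite (card_reach_extreme x) // (card_reach_extreme y) //.
rewrite card_reach_inner //.
case: (leqP t (z - 1)) => ?; case: (leqP t (n - 2 - z)) => ?;
  case: (leqP t (n - 2)) => ? //=; lia.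
Qed.

Lemma sum_reach_face_sqr {n : nat} (x y : 'I_n) :
  extreme x -> ~~ extreme y ->
  \sum_(1 <= t < n) #|reach x t| * #|reach y t| * #|reach y t| =
  n - 2 + 3 * (n - 3) + 2 * minn (y - 1) (n - 2 - y).
Proof.
move=> ex ey; have yn := ltn_ord y.
(* For indicators [a], [b], [(1 + a + b)^2 = 1 + 3 (a + b) + 2 a b]. The factor [t <= n - 2] changes
   only the term 1, both other thresholds being below [n - 2]. *)
transitivity (1 * (n - 2) + 3 * ((y - 1) + (n - 2 - y))
              + 2 * minn (y - 1) (n - 2 - y)); last first.
  by move: ey; rewrite /extreme; lia.
rewrite -(@sum_leq_combination n); [|lia..].
apply: eq_big_nat => t /andP[t0 _].
rewrite (card_reach_extreme x) // card_reach_inner // leq_min.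
case: (leqP t (y - 1)) => ?; case: (leqP t (n - 2 - y)) => ?;
  case: (leqP t (n - 2)) => ? //=; lia.
Qed.

(** Twice a mixed product is at most the sum of the two squares. The minimum in a sum of squares is
    at most [(n - 3) / 2] rounded down, and the rounding gives the parity term. *)
Lemma sum_reach_face_le {n : nat} (x y z : 'I_n) : 4 <= n ->
  extreme x -> ~~ extreme y -> ~~ extreme z ->
  \sum_(1 <= t < n) #|reach x t| * #|reach y t| * #|reach z t| <=
  5 * (n - 2) - 4 - (n - 2 - 1) %% 2.
Proof.
move=> n4 ex ey ez; rewrite -(leq_pmul2l (isT : 0 < 2)) big_distrr /=.
apply: (@leq_trans (\sum_(1 <= t < n)
    (#|reach x t| * #|reach y t| * #|reach y t|
     + #|reach x t| * #|reach z t| * #|reach z t|))).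
  apply: leq_sum => t _; rewrite -!mulnA -mulnDr mulnCA leq_mul2l.
  by rewrite !mulnn (nat_Cauchy #|reach y t| #|reach z t|) orbT.
rewrite big_split /= !sum_reach_face_sqr //; lia.
Qed.

(** Both inner coordinates equal [(n - 1) / 2], so the sum is one of squares and its minimum is
    exactly [(n - 3) / 2]. *)
Lemma sum_reach_face_centre {n : nat} (x y z : 'I_n) : 4 <= n ->
  extreme x -> y.*2.+1 = n -> z.*2.+1 = n ->
  \sum_(1 <= t < n) #|reach x t| * #|reach y t| * #|reach z t| =
  5 * (n - 2) - 4 - (n - 2 - 1) %% 2.
Proof.
move=> n4 ex yE zE; have -> : z = y by apply: val_inj => /=; lia.
have ey : ~~ extreme y by rewrite /extreme; lia.
by rewrite sum_reach_face_sqr //; lia.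
Qed.

(** * Cubes and the bound in the core *)

Lemma sum_reach_inner_cube {n : nat} (x : 'I_n) : ~~ extreme x ->
  \sum_(1 <= t < n) #|reach x t| * #|reach x t| * #|reach x t| =
  n - 1 + 7 * (n - 3) + 12 * minn (x - 1) (n - 2 - x).
Proof.
move=> ex; have xn := ltn_ord x.
(* Here [(1 + a + b)^3 = 1 + 7 (a + b) + 12 a b]; the threshold [n - 1] makes the leading indicator
   1 on the whole range. *)
transitivity (1 * (n - 1) + 7 * ((x - 1) + (n - 2 - x))
              + 12 * minn (x - 1) (n - 2 - x)); last first.
  by move: ex; rewrite /extreme; lia.
rewrite -(@sum_leq_combination n); [|lia..].
apply: eq_big_nat => t /andP[t0 tn].
rewrite card_reach_inner // leq_min.
case: (leqP t (x - 1)) => ?; case: (leqP t (n - 2 - x)) => ? //=; lia.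
Qed.

(** The [amgm] inequalities add up to bound [6 a b c] by the six terms [x^2 y], which the [rearr]
    inequalities bound by [2 (a^3 + b^3 + c^3)]. *)
Lemma AMGM3 (a b c : nat) :
  3 * (a * b * c) <= a * a * a + b * b * b + c * c * c.
Proof.
have rearr (x y : nat) : x * x * y + x * y * y <= x * x * x + y * y * y.
  (* The difference of the sides is [(x + y) (x - y)^2]. *)
  by case: (leqP x y) => [/subnKC<-|/ltnW/subnKC<-]; nia.
have amgm (x y z : nat) : 2 * (x * y * z) <= x * x * z + y * y * z.
  rewrite mulnA -mulnDl leq_mul2r; apply/orP; right.
  by rewrite !mulnn (nat_Cauchy x y).
have := (rearr a b, rearr b c, rearr a c, amgm a b c, amgm b c a, amgm a c b).
by move=> [[[[[]]]]]; nia.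
Qed.

(** Each sum of cubes is at most [n - 1 + 13 (n - 3)], twelve times the minimum being at most
    [6 (n - 3)]; the correction for [q] then removes [n - 2]. *)
Lemma kappa_core_le {n : nat} (q : vertex n) : 4 <= n -> q \in core n ->
  kappa q <= 13 * (n - 2) - 12.
Proof.
move=> n4 qC; have := kappa_sum_reach q; rewrite qC.
move: qC; rewrite mem_core /num_extreme /= addn0 !addn_eq0 !eqb0.
case/and3P=> ex ey ez.
have : 3 * \sum_(1 <= t < n)
      #|reach q.1.1 t| * #|reach q.1.2 t| * #|reach q.2 t|
  <= \sum_(1 <= t < n) (#|reach q.1.1 t| * #|reach q.1.1 t| * #|reach q.1.1 t|
      + #|reach q.1.2 t| * #|reach q.1.2 t| * #|reach q.1.2 t|
      + #|reach q.2 t| * #|reach q.2 t| * #|reach q.2 t|).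
  by rewrite big_distrr; apply: leq_sum => t _; apply: AMGM3.
rewrite !big_split /= !sum_reach_inner_cube //; lia.
Qed.

(** AM-GM is an equality on the diagonal. This serves the board centre for odd [n] and a diagonal
    point next to it for even [n]. *)
Lemma kappa_diagonal {n : nat} (x : 'I_n) : 3 <= n -> ~~ extreme x ->
  kappa ((x, x, x) : vertex n) =
  7 * (n - 3) + 12 * minn (x - 1) (n - 2 - x) + 1.
Proof.
move=> n3 ex; have := kappa_sum_reach ((x, x, x) : vertex n).
rewrite mem_core /num_extreme /= (negPf ex) /= sum_reach_inner_cube //; lia.
Qed.

Lemma kappa_boundary {n : nat} (q : vertex n) : q \notin core n ->
  kappa q =
  \sum_(1 <= t < n) #|reach q.1.1 t| * #|reach q.1.2 t| * #|reach q.2 t|.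
Proof. by move=> /negPf qC; have := kappa_sum_reach q; rewrite qC /=; lia. Qed.

(** * Rational midpoints and parity *)

Lemma midcoordP (n x : nat) : (x%:R)%R = midcoord n -> x.*2.+1 = n.
Proof.
rewrite /midcoord => xE.
have : (x.*2.+1%:R = n%:R :> rat)%R.
  by rewrite -natr1 -muln2 natrM xE divfK // subrK.
by move/eqP; rewrite eqr_nat => /eqP.
Qed.

Lemma midcoord_int (n : nat) : (midcoord n \is a Num.int) = odd n.
Proof.
apply/idP/idP => [/intrP[z]|on].
  rewrite /midcoord => /(congr1 (fun r => r * 2)%R); rewrite divfK // => zE.
  have : (n%:Z - 1 = z * 2)%R.
    apply/eqP; rewrite -(eqr_int rat) rmorphB rmorphM /=; apply/eqP.
    by rewrite -zE.
  by lia.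
have -> : n = (n./2 * 2).+1 by rewrite muln2 -[LHS]odd_double_half on.
by rewrite /midcoord -natr1 addrK natrM mulfK // natr_int.
Qed.

Theorem theorem2 (n m : nat) (hn : 4 <= n) (hm : m = n - 2) :
  (forall q : vertex n, is_corner q -> kappa q = m) /\
  (forall q : vertex n, is_edge q -> ~~ is_corner q -> kappa q = 2 * m - 1) /\
  ((forall q : vertex n, is_face q -> ~~ is_edge q ->
      kappa q <= 5 * m - 4 - (m - 1) %% 2) /\
   (forall (q : vertex n) (i : 'I_3) (s : bool),
      vertex_point q = face_centre n i s ->
      kappa q = 5 * m - 4 - (m - 1) %% 2) /\
   (forall (i : 'I_3) (s : bool),
      lattice_point (face_centre n i s) <-> odd m)) /\
  ((forall q : vertex n, q \in core n -> kappa q <= 13 * m - 12) /\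
   (forall q : vertex n,
      vertex_point q = board_centre n -> kappa q = 13 * m - 12)) /\
  \max_(q in ~: core n) kappa q < \max_(q in core n) kappa q.
Proof.
have Hcorner (q : vertex n) : is_corner q -> kappa q = m.
  move=> qc; rewrite kappa_boundary ?mem_core ?(eqP qc) // hm.
  move: qc; rewrite /is_corner /num_extreme /= => qc.
  by apply: sum_reach_corner; lia.
have Hedge (q : vertex n) : is_edge q -> ~~ is_corner q -> kappa q = 2 * m - 1.
  move=> qe qc; rewrite kappa_boundary ?mem_core -?lt0n ?(ltnW qe) // hm.
  move: qe qc; rewrite /is_edge /is_corner /num_extreme /=.
  case ex: (extreme q.1.1); case ey: (extreme q.1.2);
    case ez: (extreme q.2) => // _ _.
  - by apply: sum_reach_edge; rewrite ?ex ?ey ?ez //; lia.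
  (* The factors are permuted so that the extreme coordinates come first. *)
  - under eq_bigr do rewrite mulnAC.
    by apply: sum_reach_edge; rewrite ?ex ?ey ?ez //; lia.
  - under eq_bigr do rewrite mulnC mulnCA mulnC.
    by apply: sum_reach_edge; rewrite ?ex ?ey ?ez //; lia.
have Hface (q : vertex n) : is_face q -> ~~ is_edge q ->
    kappa q <= 5 * m - 4 - (m - 1) %% 2.
  move=> qf qe; rewrite kappa_boundary ?mem_core -?lt0n // hm.
  move: qf qe; rewrite /is_face /is_edge /num_extreme /=.
  case ex: (extreme q.1.1); case ey: (extreme q.1.2);
    case ez: (extreme q.2) => // _ _.
  - by apply: sum_reach_face_le; rewrite ?ex ?ey ?ez.
  - under eq_bigr do rewrite [X in X * _]mulnC.
    by apply: sum_reach_face_le; rewrite ?ex ?ey ?ez.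
  - under eq_bigr do rewrite mulnC mulnA.
    by apply: sum_reach_face_le; rewrite ?ex ?ey ?ez.
have extreme_end (x : 'I_n) (s : bool) :
    (x%:R = (if s then n%:R - 1 else 0 : rat))%R -> extreme x.
  rewrite /extreme; case: s => [/eqP|/eqP]; last by rewrite pnatr_eq0 => ->.
  by rewrite eq_sym subr_eq natr1 eqr_nat => /eqP nE; lia.
have face_notin_core (q : vertex n) :
    extreme q.1.1 || extreme q.1.2 || extreme q.2 -> q \notin core n.
  by rewrite mem_core /num_extreme /=; lia.
split=> //; split=> //; split; first split=> //.
  split=> [q i s | i s].
    case: q i => [[a b] c] [[|[|[|//]]] ?];
      rewrite /vertex_point /face_centre /= => -[] Ea Eb Ec.
    + have ea := extreme_end _ _ Ea; rewrite kappa_boundary ?hm.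
        by apply: sum_reach_face_centre => //; apply: midcoordP.
      by apply: face_notin_core; rewrite /= ea.
    + have eb := extreme_end _ _ Eb; rewrite kappa_boundary ?hm.
        under eq_bigr do rewrite [X in X * _]mulnC.
        by apply: sum_reach_face_centre => //; apply: midcoordP.
      by apply: face_notin_core; rewrite /= eb orbT.
    + have ec := extreme_end _ _ Ec; rewrite kappa_boundary ?hm.
        under eq_bigr do rewrite mulnC mulnA.
        by apply: sum_reach_face_centre => //; apply: midcoordP.
      by apply: face_notin_core; rewrite /= ec orbT.
  have -> : odd m = odd n by lia.
  have endI : (if s then n%:R - 1 else 0 : rat)%R \is a Num.int.
    by case: s; rewrite ?int_num0 ?rpredB ?natr_int ?int_num1.
  by case: i => [[|[|[|//]]] ?];
    rewrite /lattice_point /face_centre /= !midcoord_int; split=> [[]|].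
split.
  split=> q; first by rewrite hm; apply: kappa_core_le.
  case: q => [[a b] c]; rewrite /vertex_point /board_centre.
  case=> /midcoordP Ea /midcoordP Eb /midcoordP Ec.
  have -> : b = a by apply: val_inj => /=; lia.
  have -> : c = a by apply: val_inj => /=; lia.
  by rewrite kappa_diagonal /extreme; lia.
(* For odd [n] this gives the centre. For even [n] the point [(c, c, c)] has value [13 m - 18],
   which still exceeds [5 m - 4] as [m >= 2]. *)
have cn : (n - 1)./2 < n by lia.
pose c := Ordinal cn.
have ec : ~~ extreme c by rewrite /extreme /=; lia.
have cC : ((c, c, c) : vertex n) \in core n.
  by rewrite mem_core /num_extreme /= (negPf ec).
apply: (@leq_trans (kappa ((c, c, c) : vertex n))); last first.
  exact: (@leq_bigmax_cond _ (mem (core n)) (@kappa n) (c, c, c)).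
rewrite kappa_diagonal //; last lia.
(* [5 m - 4] bounds the corner, edge and face values alike. *)
apply: (@leq_ltn_trans (5 * m - 4)); last by rewrite /=; lia.
apply/bigmax_leqP => q; rewrite inE mem_core -lt0n => qf.
have [qc|qc] := boolP (is_corner q); first by rewrite Hcorner //; lia.
have [qe|qe] := boolP (is_edge q); first by rewrite Hedge //; lia.
by apply: leq_trans (Hface q qf qe) _; lia.
Qed.
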